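(* Let $d\ge 1$ and let $K\subseteq\mathbb{R}^d$ be a convex body. (1) If $\mathrm{width}(K)\ge 2\,\mathrm{Flt}(d)\,d$, then $K$ contains a unimodular copy of the standard simplex $\Delta_d$. (2) If $\mathrm{width}(K)\ge \mathrm{Flt}(d)\,d$, then $K$ contains an $\mathbb{R}$-unimodular copy of $\Delta_d$.
   Context: A convex body is a non-empty compact convex subset of $\mathbb{R}^d$. For a non-zero linear functional $u$, $\mathrm{width}_u(K)=\max_{x,y\in K}|u(x)-u(y)|$, and the lattice width is $\mathrm{width}(K)=\min_{u\in(\mathbb{Z}^d)^*\setminus\{0\}}\mathrm{width}_u(K)$, where $(\mathbb{Z}^d)^*=\mathrm{Hom}(\mathbb{Z}^d,\mathbb{Z})$. The flatness constant is $\mathrm{Flt}(d)=\sup\{\mathrm{width}(K): K\subseteq\mathbb{R}^d \text{ convex body}, K\cap\mathbb{Z}^d=\emptyset\}$ (a finite real number). A unimodular transformation is a map $x\mapsto Ax+b$ with $A\in\mathrm{GL}(d,\mathbb{Z})$ (integer matrix of determinant $\pm1$) and $b\in\mathbb{Z}^d$; an $\mathbb{R}$-unimodular transformation is the same with $b\in\mathbb{R}^d$. For $X\subseteq\mathbb{R}^d$, $T(X)$ is called a unimodular (resp. $\mathbb{R}$-unimodular) copy of $X$ for $T$ unimodular (resp. $\mathbb{R}$-unimodular). The standard simplex is $\Delta_d=\mathrm{conv}(0,e_1,\dots,e_d)$. *)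

(* Defs.v *)
From Stdlib Require Import Reals.
From mathcomp Require Import all_boot all_algebra.

Set Implicit Arguments.
Unset Strict Implicit.
Unset Printing Implicit Defensive.

Local Open Scope R_scope.

Definition vec (d : nat) := 'I_d -> R.

Definition sumR (d : nat) (f : 'I_d -> R) : R := \big[Rplus/0]_(i < d) f i.

Definition dotR (d : nat) (u x : vec d) : R := sumR (fun i => u i * x i).

Definition is_int (r : R) : Prop := exists z : Z, r = IZR z.
Definition int_vec (d : nat) (x : vec d) : Prop := forall i, is_int (x i).

(** Convex bodies: nonempty, convex, compact (= closed and bounded, Heine-Borel;
    closedness stated sequentially, coordinatewise convergence). *)
Definition convex (d : nat) (K : vec d -> Prop) : Prop :=
  forall x y t, K x -> K y -> 0 <= t <= 1 ->
    K (fun i => t * x i + (1 - t) * y i).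

Definition bounded (d : nat) (K : vec d -> Prop) : Prop :=
  exists M, forall x, K x -> forall i, Rabs (x i) <= M.

Definition closed_set (d : nat) (K : vec d -> Prop) : Prop :=
  forall (s : nat -> vec d) (x : vec d),
    (forall n, K (s n)) -> (forall i, Un_cv (fun n => s n i) (x i)) -> K x.

Definition convex_body (d : nat) (K : vec d -> Prop) : Prop :=
  (exists x, K x) /\ convex K /\ closed_set K /\ bounded K.

(** width_u(K) = max_{x,y in K} |u(x) - u(y)|, as the least upper bound
    (the max is attained for compact K). *)
Definition is_width_dir (d : nat) (K : vec d -> Prop) (u : vec d) (w : R) : Prop :=
  is_lub (fun r => exists x y, K x /\ K y /\ r = Rabs (dotR u x - dotR u y)) w.

Definition is_glb (E : R -> Prop) (m : R) : Prop :=
  (forall r, E r -> m <= r) /\ (forall b, (forall r, E r -> b <= r) -> b <= m).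

Definition is_lattice_width (d : nat) (K : vec d -> Prop) (w : R) : Prop :=
  is_glb (fun r => exists u : vec d,
            int_vec u /\ (exists i, u i <> 0) /\ is_width_dir K u r) w.

Definition is_Flt (d : nat) (F : R) : Prop :=
  is_lub (fun r => exists K : vec d -> Prop,
            convex_body K /\ (forall z, int_vec z -> ~ K z) /\ is_lattice_width K r) F.

(** Standard simplex Delta_d = conv(0, e_1, ..., e_d). *)
Definition std_simplex (d : nat) (x : vec d) : Prop :=
  (forall i, 0 <= x i) /\ sumR x <= 1.

Definition intR (z : int) : R :=
  match z with Posz n => INR n | Negz n => - INR n.+1 end.

Definition unimodular_mx (d : nat) (A : 'M[int]_d) : Prop :=
  (\det A = 1)%R \/ (\det A = -1)%R.

Definition affine_map (d : nat) (A : 'M[int]_d) (b : vec d) (x : vec d) : vec d :=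
  fun i => sumR (fun j => intR (A i j) * x j) + b i.

Definition contains_unimodular_simplex (d : nat) (K : vec d -> Prop) : Prop :=
  exists (A : 'M[int]_d) (b : vec d), unimodular_mx A /\ int_vec b /\
    forall x, std_simplex x -> K (affine_map A b x).

Definition contains_R_unimodular_simplex (d : nat) (K : vec d -> Prop) : Prop :=
  exists (A : 'M[int]_d) (b : vec d), unimodular_mx A /\
    forall x, std_simplex x -> K (affine_map A b x).

(* Main.v *)
(** Scale [K] by [1 / d] and call the result [M].  Flatness forces, for every
    nonzero integer functional [u], a lattice vector [z] with [u z <> 0] and
    [a, a + z \in M]: push a translate of [M] slightly against the hyperplane
    where [u] is maximal, so that the lattice points it still contains have
    [u < 0].  Choosing [u] to vanish on the lattice vectors found so far and
    dividing [z] by a content, one builds a lattice basis [v_1, ..., v_d] and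
    segments [[a_j, a_j + s_j]] in [M] with [s_j - v_j] in the real span of
    [v_1, ..., v_(j-1)].  The sum [B] of these [d] segments lies in [K].  Since
    the [s_j] are triangular over the basis, the translates of [B] by the lattice
    cover the space, and each [v_j] can be corrected by earlier [v_i] so that
    [sum a_j + v_j] lies in [B].  This is the second claim.  If there is room for
    [B + B], the covering property supplies a summand that makes the vertex of
    the simplex integral, which is the first claim. *)
Require Import Defs.
From Stdlib Require Import Reals Lra.
From mathcomp Require Import all_boot all_order all_algebra.
From mathcomp Require Import boolp Rstruct zify.
Import Order.TTheory GRing.Theory Num.Theory.
Local Open Scope R_scope.

Set Implicit Arguments.
Unset Strict Implicit.
Unset Printing Implicit Defensive.

(** * Reduction of an integer column by unimodular matrices *)

Section UnimodularSimplex.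
Local Open Scope ring_scope.

(** In the Smith form of a single column only the top diagonal entry matters, and the 1 x 1 right
    factor is absorbed into [g], which is therefore the content of [y] up to sign. *)
Lemma int_col_smith m (y : 'cV[int]_m.+1) : y != 0 ->
  exists L : 'M[int]_m.+1, exists2 g : int, g != 0 &
    L \in unitmx /\ y = L *m (g *: delta_mx 0 0).
Proof.
move=> y0; have [L uL [Q uQ [s _ Dy]]] := int_Smith_normal_form y.
set D := \matrix_(i, j) _ in Dy.
have DE : D *m Q = (s`_0 * Q 0 0) *: delta_mx 0 0.
  apply/matrixP=> i j; rewrite !ord1 !mxE big_ord1 !mxE eqxx andbT -val_eqE /=.
  case: (eqVneq (nat_of_ord i) 0%N) => [->|_]; rewrite ?mulr1n ?mulr0n ?mulr1 ?mulr0 ?mul0r //.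
have Dy' : y = L *m ((s`_0 * Q 0 0) *: delta_mx 0 0) by rewrite {1}Dy -mulmxA DE.
exists L, (s`_0 * Q 0 0) => //.
by apply: contraNneq y0 => g0; rewrite Dy' g0 scale0r mulmx0.
Qed.

(** Only the entries of [y] from index [k] on are reduced, by a block diagonal matrix with an
    identity block. Hence [U] fixes the first [k] basis vectors, and basis vectors found earlier
    survive the change of basis. *)
Lemma int_col_reduce d (k : 'I_d) (y : 'cV[int]_d) : y k 0 != 0 ->
  exists U : 'M[int]_d, exists c : 'cV[int]_d,
  [/\ U \in unitmx, forall i j : 'I_d, (j < k)%N -> U i j = (i == j)%:R,
      forall i : 'I_d, (k < i)%N -> c i 0 = 0, c k 0 != 0 & y = U *m c].
Proof.
have [k' [m [Ek Dd]]] : exists k', exists m, nat_of_ord k = k' /\ d = (k' + m.+1)%N.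
  by exists k, (d - k.+1)%N; split=> //; have := ltn_ord k; lia.
subst d => yk.
have Dk : k = rshift k' 0 by apply/val_inj; rewrite /= addn0.
have y0 : dsubmx y != 0.
  by apply: contraNneq yk => y0; rewrite Dk -[y]vsubmxK y0 col_mxEd mxE.
have [L [g g0 [uL Dy]]] := int_col_smith y0.
exists (block_mx 1%:M 0 0 L), (col_mx (usubmx y) (g *: delta_mx 0 0)); split.
- by rewrite unitmxE det_ublock det1 mul1r -unitmxE.
- move=> i j; case: (split_ordP j) => [j' -> _|j' ->]; last by rewrite /= Ek ltnNge leq_addr.
  case: (split_ordP i) => i' ->.
    by rewrite block_mxEul mxE (inj_eq (@lshift_inj _ _)).
  by rewrite block_mxEdl mxE eq_rlshift.
- move=> i; case: (split_ordP i) => i' ->; rewrite Ek /= => lt_k; first by have := ltn_ord i'; lia.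
  rewrite col_mxEd !mxE -val_eqE /=; case: eqP => [i0|]; last by rewrite mulr0.
  by rewrite i0 addn0 ltnn in lt_k.
- by rewrite Dk col_mxEd !mxE !eqxx mulr1.
- by rewrite mul_block_col mul1mx !mul0mx addr0 add0r -Dy vsubmxK.
Qed.

Variable R : archiRealFieldType.
Local Notation "A %:Rmx" := (map_mx (intr : int -> R) A) (at level 2, format "A %:Rmx").

(** * Covering space by lattice translates of a triangular box *)

Definition unitriangular d (T : 'M[R]_d) :=
  forall i j : 'I_d, (j <= i)%N -> T i j = (i == j)%:R.

(** Back substitution from the last coordinate: its floor goes to [n], its fractional part to [t],
    and the rest has one coordinate fewer. The supports are tracked because they later make the
    corrected basis triangular. *)
Lemma unitriangular_cover d (T : 'M[R]_d) : unitriangular T ->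
  forall k (q : 'cV[R]_d), (forall i : 'I_d, (k <= i)%N -> q i 0 = 0) ->
  exists t : 'cV[R]_d, exists n : 'cV[int]_d,
  [/\ forall i, 0 <= t i 0 <= 1, forall i : 'I_d, (k <= i)%N -> t i 0 = 0,
      forall i : 'I_d, (k <= i)%N -> n i 0 = 0 & q = T *m t + n%:Rmx].
Proof.
move=> triT; elim=> [|k IHk] q qk.
  exists 0, 0; split=> [i|i _|i _|]; rewrite ?mxE ?lexx ?ler01 //.
  rewrite mulmx0 add0r map_mx0; apply/matrixP=> i j.
  by rewrite ord1 mxE qk.
have [lt_kd|le_dk] := ltnP k d; last first.
  have [|t [n [t01 tk nk Dq]]] := IHk q.
    by move=> i /(leq_trans le_dk); rewrite leqNgt ltn_ord.
  by exists t, n; split=> // i /ltnW; [apply: tk | apply: nk].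
pose i0 := Ordinal lt_kd; pose m := Num.floor (q i0 0).
pose f := q i0 0 - m%:~R.
have f01 : 0 <= f <= 1.
  have /andP[] := floor_itv (q i0 0); rewrite -/m intrD /f => lo hi.
  by rewrite subr_ge0 lo lerBlDl ltW.
(* Column [i0] of [T] has 1 at [i0] and 0 below it, so [q'] vanishes from index [k] on. *)
pose q' := q - f *: col i0 T - (m *: delta_mx i0 0)%:Rmx.
have [|t [n [t01 tk nk Dq']]] := IHk q'.
  move=> i; rewrite leq_eqVlt => /predU1P[ki|lt_ki].
    have -> : i = i0 by apply/val_inj.
    by rewrite !mxE triT // !eqxx !mulr1 subKr subrr.
  rewrite !mxE qk // triT ?(ltnW lt_ki) //.
  have /negPf-> : i != i0 by rewrite -val_eqE /= gtn_eqF.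
  by rewrite /= !mulr0 mulr0z !subr0.
exists (t + f *: delta_mx i0 0), (n + m *: delta_mx i0 0); split.
- move=> i; rewrite !mxE eqxx andbT; case: eqP => [->|_] /=.
    by rewrite tk // add0r mulr1.
  by rewrite mulr0 addr0.
- move=> i lt_ki; rewrite !mxE tk 1?ltnW // -val_eqE /= gtn_eqF //.
  by rewrite mulr0 addr0.
- move=> i lt_ki; rewrite !mxE nk 1?ltnW // -val_eqE /= gtn_eqF //.
  by rewrite mulr0 addr0.
- rewrite map_mxD mulmxDr addrACA -Dq' -scalemxAr -colE /q'.
  by rewrite [X in _ + X]addrC addrA !subrK.
Qed.

(** * Convex combinations of column vectors *)

Definition convex_mx d (K : 'cV[R]_d -> Prop) :=
  forall x y t, K x -> K y -> 0 <= t <= 1 -> K (t *: x + (1 - t) *: y).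

Lemma convex_mx_average d (K : 'cV[R]_d -> Prop) : convex_mx K ->
  forall n (y : 'I_n -> 'cV[R]_d), (0 < n)%N -> (forall i, K (y i)) ->
  K (n%:R^-1 *: \sum_i y i).
Proof.
move=> cK; elim=> [|[|n] IHn] // y _ Ky; first by rewrite big_ord1 invr1 scale1r.
rewrite big_ord_recr /=.
have n1 : 0 < n.+1%:R :> R by rewrite ltr0n.
have n2 : 0 < n.+2%:R :> R by rewrite ltr0n.
have Dn : n.+2%:R = n.+1%:R + 1 :> R by rewrite -natr1.
have := cK _ (y ord_max) (n.+1%:R / n.+2%:R) (IHn _ isT (fun i => Ky (widen_ord (leqnSn _) i))) (Ky _).
rewrite scalerA scalerDr.
have -> : n.+1%:R / n.+2%:R / n.+1%:R = n.+2%:R^-1 :> R.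
  by rewrite mulrAC divff ?mul1r ?gt_eqF.
have -> : 1 - n.+1%:R / n.+2%:R = n.+2%:R^-1 :> R.
  by rewrite -[X in X - _](@divff _ n.+2%:R) ?gt_eqF // -mulrBl Dn addrAC subrr add0r mul1r.
by apply; rewrite divr_ge0 ?ler0n ?/= ?ler_pdivrMr ?mul1r ?ler_nat.
Qed.

(* Either endpoint may serve as [a'], according to the sign of [c]. *)
Lemma convex_mx_segment_div d (K : 'cV[R]_d -> Prop) a z (c : int) :
  convex_mx K -> c != 0 -> K a -> K (a + z) ->
  exists2 a', K a' & K (a' + c%:~R^-1 *: z).
Proof.
move=> cK c0 Ka Kaz; have [c_gt0|c_lt0|/eqP] := ltgtP 0 c; last by rewrite eq_sym (negPf c0).
  have c1 : 1 <= c%:~R :> R by rewrite ler1z; lia.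
  exists a => //; have := cK _ _ (c%:~R^-1) Kaz Ka.
  rewrite scalerDr addrAC -scalerDl addrC addrC subrKC scale1r; apply.
  by rewrite invr_ge0 invf_le1 ?(le_trans ler01) ?(lt_le_trans ltr01).
have c1 : 1 <= (- c)%:~R :> R by rewrite ler1z; lia.
exists (a + z) => //; have := cK _ _ ((- c)%:~R^-1) Ka Kaz.
set e := _^-1; have -> : c%:~R^-1 = - e :> R by rewrite /e intrN invrN opprK.
have -> : e *: a + (1 - e) *: (a + z) = a + z + - e *: z.
  by rewrite scalerBl scale1r scalerDr scaleNr addrCA opprD addNKr.
apply; by rewrite invr_ge0 invf_le1 ?(le_trans ler01) ?(lt_le_trans ltr01).
Qed.

(** * The adapted lattice basis and the simplex in the box *)

(** The form in which flatness enters: the lattice vectors joining two points of [M] lie in no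
    common rational hyperplane through the origin. *)
Definition lattice_steps d (M : 'cV[R]_d -> Prop) :=
  forall u : 'rV[int]_d, u != 0 ->
  exists a : 'cV[R]_d, exists z : 'cV[int]_d, [/\ M a, M (a + z%:Rmx) & (u *m z) 0 0 != 0].

(** Column [j] of [A] is v_j, and column [j] of [T] holds the coordinates of s_j in this basis.
    Unitriangularity says that s_j - v_j is spanned by earlier basis vectors. Columns from [k] on
    carry no segment yet. *)
Lemma lattice_steps_flag d (M : 'cV[R]_d -> Prop) : convex_mx M -> lattice_steps M ->
  forall k, (k <= d)%N -> exists A : 'M[int]_d, exists T : 'M[R]_d,
  [/\ A \in unitmx, unitriangular T &
      forall j : 'I_d, (j < k)%N -> exists2 a, M a & M (a + A%:Rmx *m col j T)].
Proof.
move=> cM stepM; elim=> [_|k IHk lt_kd].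
  by exists 1%:M, 1%:M; split=> // [|i j _]; rewrite ?unitmx1 ?mxE.
have [A [T [uA triT segT]]] := IHk (ltnW lt_kd).
pose i0 := Ordinal lt_kd.
(* This row is the functional that vanishes on every column of [A] but column [k], in particular on
   the basis vectors already found. *)
have u0 : row i0 (invmx A) != 0.
  apply/eqP=> u0; have /matrixP/(_ 0 i0) : row i0 (invmx A *m A) = 0 by rewrite row_mul u0 mul0mx.
  by rewrite mulVmx // !mxE eqxx.
have [a [z [Ma Maz uz]]] := stepM _ u0.
have y0 : (invmx A *m z) i0 0 != 0 by move: uz; rewrite -row_mul mxE.
have [U [c [uU U1 c0 ck0 Dy]]] := int_col_reduce y0.
have Dz : z = A *m U *m c by rewrite -mulmxA -Dy mulKVmx.
have ckR : (c i0 0)%:~R != 0 :> R by rewrite intr_eq0.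
(* The new column holds the coordinates of [z] in the basis [A *m U], divided by the last nonzero
   one: 1 at index [k], 0 after it. *)
pose T' := \matrix_(i, j) if j == i0 then (c i 0)%:~R / (c i0 0)%:~R else T i j.
exists (A *m U), T'.
split=> [|i j le_ji|j].
- by rewrite unitmx_mul uA.
- rewrite mxE; case: (eqVneq j i0) le_ji => [->|_] le_ji; last exact: triT.
  have [->|ne_i] := eqVneq i i0; first by rewrite divff.
  by rewrite c0 ?mul0r // ltn_neqAle le_ji andbT eq_sym.
rewrite ltnS leq_eqVlt => /predU1P[jk|lt_jk].
  have -> : j = i0 by apply/val_inj.
  have -> : col i0 T' = (c i0 0)%:~R^-1 *: c%:Rmx.
    by apply/matrixP=> i l; rewrite ord1 !mxE eqxx mulrC.
  by rewrite -scalemxAr -map_mxM -Dz; exact: (convex_mx_segment_div cM ck0 Ma Maz).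
have [b Mb Mbs] := segT j lt_jk; exists b => //.
(* Column [j] of [T] is supported on indices below [k], where [U] fixes the basis vectors, so the
   old segments are unchanged. *)
have UT : U%:Rmx *m col j T = col j T.
  rewrite -[RHS]mul1mx; apply/matrixP=> i l; rewrite !mxE; apply: eq_bigr => m _.
  rewrite !mxE; have [le_mj|lt_jm] := leqP m j.
    by rewrite U1 ?(leq_ltn_trans le_mj) // rmorph_nat.
  by rewrite triT ?(ltnW lt_jm) // -val_eqE /= gtn_eqF // !mulr0.
have -> : col j T' = col j T.
  apply/matrixP=> i l; rewrite !mxE; case: eqP => // ji0.
  by move: lt_jk; rewrite ji0 ltnn.
by rewrite map_mxM -mulmxA UT.
Qed.

Lemma mulmx_sum_col m n (B : 'M[R]_(m, n)) (t : 'cV[R]_n) :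
  B *m t = \sum_j t j 0 *: col j B.
Proof.
apply/matrixP=> i l; rewrite ord1 summxE mxE; apply: eq_bigr => j _.
by rewrite !mxE mulrC.
Qed.

Lemma lattice_steps_simplex d (K : 'cV[R]_d -> Prop) : (0 < d)%N -> convex_mx K ->
  lattice_steps (fun x => K (d%:R *: x)) ->
  exists A : 'M[int]_d, exists x : 'cV[R]_d, [/\ A \in unitmx,
    forall p : 'cV[R]_d, (forall i, 0 <= p i 0) -> \sum_i p i 0 <= 1 -> K (A%:Rmx *m p + x) &
    forall p : 'cV[R]_d, exists n : 'cV[int]_d, K (p + n%:Rmx)].
Proof.
move=> d_gt0 cK stepK.
have cM : convex_mx (fun x => K (d%:R *: x)).
  move=> x y t Kx Ky t01; have := cK _ _ _ Kx Ky t01.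
  by rewrite !scalerA [t * _]mulrC [(1 - t) * _]mulrC -!scalerA -scalerDr.
have [A [T [uA triT segT]]] := lattice_steps_flag cM stepK (leqnn d).
have [a Ka Kas] := fin_all_exists2 (fun j => segT j (ltn_ord j)).
pose x := \sum_j a j.
have uAR : A%:Rmx \in unitmx by rewrite unitmxE det_map_mx rmorph_unit -?unitmxE.
(* The box is a sum of [d] segments lying in [K] scaled by 1/d, so each of its points is the average
   of [d] points [y j] of [K]. *)
have boxK (t : 'cV[R]_d) : (forall i, 0 <= t i 0 <= 1) -> K (A%:Rmx *m (T *m t) + x).
  move=> t01; pose y j := d%:R *: (t j 0 *: (a j + A%:Rmx *m col j T) + (1 - t j 0) *: a j).
  have Ky j : K (y j) by apply: cM.
  have -> : A%:Rmx *m (T *m t) + x = d%:R^-1 *: \sum_j y j.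
    rewrite -scaler_sumr scalerA mulVf ?scale1r ?pnatr_eq0 -?lt0n //.
    rewrite mulmxA mulmx_sum_col -big_split /=; apply: eq_bigr => j _.
    rewrite colE -mulmxA -colE scalerDr scalerBl scale1r.
    by rewrite [_ *: a j + _]addrC -addrA [_ *: a j + _]addrC subrK.
  exact: convex_mx_average.
pose q j : 'cV[R]_d := delta_mx j 0 - col j T.
have q0 (j i : 'I_d) : (j <= i)%N -> q j i 0 = 0.
  by move=> le_ji; rewrite !mxE triT // eqxx andbT subrr.
have /fin_all_exists[t /fin_all_exists[n tn]] := fun j => unitriangular_cover triT (q0 j).
(* Covering [q j] by the box reads T (e_j + t_j) = e_j - n_j. The columns of [N] are the corrected
   basis vectors, and those of [P] their box parameters. *)
pose N := \matrix_(i, j) ((i == j)%:R - n j i 0).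
pose P := \matrix_(i, j) t j i 0 + 1%:M.
have detN : \det N = 1.
  rewrite -det_tr det_trig.
    rewrite big1 // => j _; have [_ _ nj _] := tn j.
    by rewrite !mxE eqxx nj // subr0.
  apply/is_trig_mxP=> i j lt_ij; have [_ _ nj _] := tn i.
  by rewrite !mxE nj 1?ltnW // -val_eqE /= gtn_eqF // subr0.
have TP : T *m P = N%:Rmx.
  apply/matrixP=> i j; have [_ _ _ /matrixP/(_ i 0)] := tn j.
  rewrite mulmxDr mulmx1 !mxE eqxx andbT => /eqP.
  rewrite subr_eq addrAC -subr_eq rmorphB /= rmorph_nat => /eqP->.
  by congr (_ + _); apply: eq_bigr => l _; rewrite mxE.
exists (A *m N), x; split.
- by rewrite unitmx_mul uA unitmxE detN unitr1.
- move=> p p0 p1; rewrite map_mxM -TP -!mulmxA; apply: boxK => i.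
  (* Since [t j] vanishes at index [j], adding the identity does not push the diagonal of [P] above
     1. *)
  have P01 j : 0 <= P i j <= 1.
    have [t01 tj _ _] := tn j; rewrite !mxE; case: eqP => [->|_]; last by rewrite addr0.
    by rewrite tj // add0r ler01 lexx.
  rewrite mxE; apply/andP; split.
    by apply: sumr_ge0 => j _; have /andP[P0 _] := P01 j; rewrite mulr_ge0.
  apply: le_trans p1; apply: ler_sum => j _; have /andP[_ P1] := P01 j.
  by rewrite ler_piMl.
move=> p; have [|s [m [s01 _ _ Ds]]] := unitriangular_cover triT (k := d) (q := invmx A%:Rmx *m (p - x)).
  by move=> i; rewrite leqNgt ltn_ord.
exists (- (A *m m)); rewrite map_mxN map_mxM.
have -> : p - A%:Rmx *m m%:Rmx = A%:Rmx *m (T *m s) + x.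
  apply/eqP; rewrite subr_eq addrAC -mulmxDr -Ds mulKVmx //.
  by rewrite subrK.
exact: boxK.
Qed.

End UnimodularSimplex.

(** * Limits and cluster points of real sequences *)

Lemma Rabs_scale a x : 0 < a -> a * Rabs x = Rabs (a * x).
Proof. by move=> a0; rewrite Rabs_mult (Rabs_pos_eq a) //; lra. Qed.

Lemma Un_cv_const (c : R) : Un_cv (fun=> c) c.
Proof. by move=> e e0; exists 0%N => n _; rewrite /Rdist Rminus_diag Rabs_R0. Qed.

(** Extraction maps are only required to satisfy n <= phi n: this preserves limits and comes
    directly from a cluster point. *)
Lemma Un_cv_reindex (s : nat -> R) l (phi : nat -> nat) :
  (forall n, (n <= phi n)%N) -> Un_cv s l -> Un_cv (fun n => s (phi n)) l.
Proof.
move=> ge_phi cv e /cv[N cvN]; exists N => n Nn; apply: cvN.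
have := ge_phi n; lia.
Qed.

Lemma bounded_seq_cluster (s : nat -> R) M : (forall n, Rabs (s n) <= M) ->
  exists phi l, (forall n, (n <= phi n)%N) /\ Un_cv (fun n => s (phi n)) l.
Proof.
move=> sM; have [|l adh_l] := Bolzano_Weierstrass s _ (compact_P3 (- M) M).
  by move=> n; have := sM n; split_Rabs; lra.
have /choice[phi phiP] n : exists p, (n <= p)%N /\ Rabs (s p - l) < / INR n.+1.
  have n0 : 0 < / INR n.+1 by apply/Rinv_0_lt_compat/lt_0_INR; lia.
  have [|p [np sp]] := adh_l (disc l (mkposreal _ n0)) n; last by exists p; split=> //; lia.
  by exists (mkposreal _ n0).
exists phi, l; split=> [n|e e0]; first by case: (phiP n).
have [N [Ne N0]] := archimed_cor1 e e0; exists N => n Nn.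
have [_ /Rlt_le_trans] := phiP n; apply; apply: Rle_trans (Rlt_le _ _ Ne).
by apply: Rinv_le_contravar; [apply: lt_0_INR | apply: le_INR; lia].
Qed.

(** One extraction per index, composed along the enumeration of [I]; earlier limits persist under
    reindexing. *)
Lemma bounded_family_cluster (I : finType) (s : nat -> I -> R) M :
  (forall n i, Rabs (s n i) <= M) ->
  exists phi l, (forall n, (n <= phi n)%N) /\ forall i, Un_cv (fun n => s (phi n) i) (l i).
Proof.
move=> sM.
have [phi [l [ge_phi cv]]] : exists phi l, (forall n, (n <= phi n)%N) /\
    forall i, i \in enum I -> Un_cv (fun n => s (phi n) i) (l i).
  elim: (enum I) => [|i r [phi [l [ge_phi cv]]]]; first by exists id, (fun=> 0).
  have [psi [li [ge_psi cvi]]] := bounded_seq_cluster (fun n => sM (phi n) i).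
  exists (phi \o psi), (fun j => if j == i then li else l j); split=> [n|j] /=.
    exact: leq_trans (ge_psi n) (ge_phi _).
  rewrite inE; case: eqP => [-> //|_ /=] /cv.
  exact: (@Un_cv_reindex (fun n => s (phi n) j)).
by exists phi, l; split=> // i; apply: cv; rewrite mem_enum.
Qed.

Lemma is_int_cv (s : nat -> R) l : (forall n, is_int (s n)) -> Un_cv s l -> is_int l.
Proof.
(* Integers within 1/3 of the limit differ by less than 1, so the sequence is eventually
   constant. *)
move=> s_int cv; have [|N cvN] := cv (/ 3); first lra.
have [z Dz] := s_int N; exists z; rewrite -Dz.
apply: UL_sequence cv _ => e e0; exists N => n Nn.
suff -> : s n = s N by rewrite /Rdist Rminus_diag Rabs_R0.
have [m Dm] := s_int n; have := cvN n Nn; have := cvN N (le_n N).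
rewrite /Rdist Dz Dm => ? ?; congr IZR.
have : IZR (Z.sub m z) < 1 by rewrite minus_IZR; split_Rabs; lra.
have : -1 < IZR (Z.sub m z) by rewrite minus_IZR; split_Rabs; lra.
by move=> /lt_IZR ? /lt_IZR ?; lia.
Qed.

(** * Widths under scaling, and positivity of the flatness constant *)

Section Widths.
Variable d : nat.
Implicit Types (u x y t : vec d) (K : vec d -> Prop).

(** For [mu] positive this is the body (K - t) / mu, as a preimage. *)
Definition scaled K mu t : vec d -> Prop := fun x => K (fun i => mu * x i + t i).

Lemma dotR_affine u x t mu : dotR u (fun i => mu * x i + t i) = mu * dotR u x + dotR u t.
Proof.
rewrite /dotR /sumR big_distrr -big_split /=; apply: eq_bigr => i _; ring.
Qed.

Lemma Rabs_le_sumR t i : Rabs (t i) <= sumR (fun j => Rabs (t j)).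
Proof.
rewrite /sumR (bigD1 i) //= -[X in X <= _]Rplus_0_r; apply: Rplus_le_compat_l.
by elim/big_ind: _ => [|a b|j _]; [lra | lra | apply: Rabs_pos].
Qed.

Lemma scaled_convex_body K mu t : 0 < mu -> convex_body K -> convex_body (scaled K mu t).
Proof.
move=> mu0 [[x0 Kx0] [cK [clK [M KM]]]]; split; [|split; [|split]].
- exists (fun i => (x0 i - t i) / mu); rewrite /scaled; congr K: Kx0.
  by apply: funext => i; field; lra.
- move=> x y s Kx Ky s01; have := cK _ _ _ Kx Ky s01; congr K.
  by apply: funext => i; ring.
- move=> s x Ks cv; apply: (clK (fun n i => mu * s n i + t i)) => // i.
  apply: CV_plus (Un_cv_const _); apply: CV_mult (cv i); exact: Un_cv_const.
- exists ((M + sumR (fun i => Rabs (t i))) / mu) => x Kx i.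
  have ti := Rabs_le_sumR t i.
  have := KM _ Kx i; have := Rabs_scale (x i) mu0.
  move=> Dx Mx; apply: (Rmult_le_reg_l mu) => //.
  have -> : mu * ((M + sumR (fun i => Rabs (t i))) / mu) = M + sumR (fun i => Rabs (t i)).
    by field; lra.
  have := Rabs_triang (mu * x i + t i) (- t i); rewrite Rabs_Ropp Dx.
  have -> : mu * x i + t i + - t i = mu * x i by ring.
  lra.
Qed.

Lemma is_lub_scale (E E' : R -> Prop) mu m : 0 < mu ->
  (forall r, E' r <-> E (mu * r)) -> is_lub E' m <-> is_lub E (mu * m).
Proof.
move=> mu0 E'E.
have EE' r : E r -> E' (r / mu) by move=> Er; apply/E'E; congr E: Er; field; lra.
have divK r : mu * (r / mu) = r by field; lra.
split=> -[ubm lem]; split=> [r Er|b ub_b].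
- have /ubm le_r := EE' _ Er; rewrite -(divK r); apply: Rmult_le_compat_l; lra.
- have : m <= b / mu.
    apply: lem => r /E'E /ub_b le_b; apply: (Rmult_le_reg_l mu) => //.
    by rewrite divK.
  by move/(Rmult_le_compat_l mu); rewrite divK; apply; lra.
- by apply: (Rmult_le_reg_l mu) => //; apply/ubm/E'E.
- apply: (Rmult_le_reg_l mu) => //; apply: lem => r Er.
  have /ub_b := EE' _ Er; rewrite -{2}(divK r) => ?; apply: Rmult_le_compat_l; lra.
Qed.

Lemma scaled_width_dir K mu t u r : 0 < mu ->
  is_width_dir (scaled K mu t) u r <-> is_width_dir K u (mu * r).
Proof.
move=> mu0; apply: is_lub_scale => // s; split=> [[x [y [Kx [Ky ->]]]]|[x [y [Kx [Ky Ds]]]]].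
  exists (fun i => mu * x i + t i), (fun i => mu * y i + t i); split=> //; split=> //.
  rewrite !dotR_affine Rabs_scale //; congr Rabs; ring.
pose h (z : vec d) : vec d := fun i => (z i - t i) / mu.
have hK z : z = fun i => mu * h z i + t i by apply: funext => i; rewrite /h; field; lra.
exists (h x), (h y); split; first by rewrite /scaled -hK.
split; first by rewrite /scaled -hK.
apply: (Rmult_eq_reg_l mu); last lra.
rewrite Ds {1}(hK x) {1}(hK y) !dotR_affine Rabs_scale //; congr Rabs; ring.
Qed.

Lemma scaled_lattice_width K mu t w : 0 < mu -> is_lattice_width K w ->
  is_lattice_width (scaled K mu t) (w / mu).
Proof.
move=> mu0 [lbw gew].
have divK r : mu * (r / mu) = r by field; lra.
split=> [r [u [u_int [u0 /scaled_width_dir wr]]]|b lb_b]; apply: (Rmult_le_reg_l mu) => //; rewrite divK.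
  by apply: lbw; exists u; split=> //; split=> //; apply: wr.
apply: gew => r [u [u_int [u0 wr]]].
rewrite -(divK r); apply: Rmult_le_compat_l; first lra.
apply: lb_b; exists u; split=> //; split=> //.
by apply/scaled_width_dir => //; rewrite divK.
Qed.

Lemma lattice_width_gt_Flt K F w : is_Flt d F -> convex_body K -> is_lattice_width K w ->
  F < w -> exists2 z, int_vec z & K z.
Proof.
move=> [ubF _] bK wK Fw; apply: contrapT => noz.
suff : w <= F by lra.
apply: ubF; exists K; split=> //; split=> // z z_int Kz.
by apply: noz; exists z.
Qed.

Definition std_vec (i : 'I_d) : vec d := fun j => if j == i then 1 else 0.

Lemma dotR_std_vec i x : dotR (std_vec i) x = x i.
Proof.
rewrite /dotR /sumR (bigD1 i) //= big1 => [|j /negPf ne_ji]; rewrite /std_vec ?ne_ji ?eqxx; ring.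
Qed.

Lemma dotRD u x y : dotR u (fun i => x i + y i) = dotR u x + dotR u y.
Proof. by rewrite /dotR /sumR -big_split /=; apply: eq_bigr => i _; ring. Qed.

Lemma dotRC u x : dotR u x = dotR x u.
Proof. by apply: eq_bigr => i _; ring. Qed.

Lemma dotRZ u x mu : dotR u (fun i => mu * x i) = mu * dotR u x.
Proof. by rewrite /dotR /sumR big_distrr /=; apply: eq_bigr => i _; ring. Qed.

(** A lattice-free body of positive width, which witnesses that the flatness constant is
    positive. *)
Definition middle_cube : vec d -> Prop := fun x => forall i, 1 / 3 <= x i <= 2 / 3.

Lemma middle_cube_body : convex_body middle_cube.
Proof.
split; first by exists (fun=> 1 / 3) => i; lra.
split; first by move=> x y t Qx Qy t01 i; have := Qx i; have := Qy i; nra.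
split=> [s x Qs cv i|]; last by exists 1 => x Qx i; have := Qx i; split_Rabs; lra.
split; apply: Rnot_lt_le => lt_x.
  have [|N] := cv i (1 / 3 - x i); first lra.
  by move=> /(_ N (le_n N)); have := Qs N i; rewrite /Rdist; split_Rabs; lra.
have [|N] := cv i (x i - 2 / 3); first lra.
by move=> /(_ N (le_n N)); have := Qs N i; rewrite /Rdist; split_Rabs; lra.
Qed.

Lemma middle_cube_width : (0 < d)%N -> is_lattice_width middle_cube (1 / 3).
Proof.
move=> d0; split=> [r [u [u_int [[i ui] [ub_r _]]]]|b lb_b].
  have [z Dz] := u_int i.
  have ui1 : 1 <= Rabs (u i).
    rewrite Dz -abs_IZR; apply: IZR_le; suff : z <> Z0 by lia.
    by move=> z0; apply: ui; rewrite Dz z0.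
  (* A move by 1/3 along a coordinate where [u] is a nonzero integer changes [u] by at least 1/3. *)
  suff : 1 / 3 * Rabs (u i) <= r by lra.
  apply: ub_r; exists (fun j => 1 / 3 * std_vec i j + 1 / 3), (fun=> 1 / 3).
  split; first by move=> j; rewrite /std_vec; case: eqP; lra.
  split; first by move=> j; lra.
  rewrite dotR_affine dotRC dotR_std_vec Rabs_scale; last lra.
  by congr Rabs; ring.
pose i0 := Ordinal d0; apply: lb_b; exists (std_vec i0); split.
  by move=> j; rewrite /std_vec; case: eqP => _; [exists Z.one | exists Z.zero].
split; first by exists i0; rewrite /std_vec eqxx; lra.
split=> [r [x [y [Qx [Qy ->]]]]|b' ub_b'].
  by rewrite !dotR_std_vec; have := Qx i0; have := Qy i0; split_Rabs; lra.
apply: ub_b'; exists (fun=> 2 / 3), (fun=> 1 / 3); split; first by move=> j; lra.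
split; first by move=> j; lra.
by rewrite !dotR_std_vec Rabs_pos_eq; lra.
Qed.

Lemma Flt_gt0 F : (0 < d)%N -> is_Flt d F -> 0 < F.
Proof.
move=> d0 [ubF _]; suff : 1 / 3 <= F by lra.
apply: ubF; exists middle_cube; split; first exact: middle_cube_body.
split; last exact: middle_cube_width.
move=> z z_int /(_ (Ordinal d0)); have [m ->] := z_int (Ordinal d0) => -[lo hi].
have /lt_IZR : 0 < IZR m by lra.
have /lt_IZR : IZR m < 1 by lra.
lia.
Qed.

(** * Lattice steps from flatness *)

Lemma is_int_dotR u x : int_vec u -> int_vec x -> is_int (dotR u x).
Proof.
move=> u_int x_int; rewrite /dotR /sumR; elim/big_ind: _ => [|a b [m ->] [n ->]|i _].
- by exists Z.zero.
- by exists (Z.add m n); rewrite plus_IZR.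
have [m ->] := u_int i; have [n ->] := x_int i.
by exists (Z.mul m n); rewrite mult_IZR.
Qed.

Lemma Un_cv_dotR u (s : nat -> vec d) x :
  (forall i, Un_cv (fun n => s n i) (x i)) -> Un_cv (fun n => dotR u (s n)) (dotR u x).
Proof.
move=> cv; rewrite /dotR /sumR; elim: (index_enum _) => [|i r IHr].
  by rewrite big_nil; under eq_fun do rewrite big_nil; apply: Un_cv_const.
rewrite big_cons; under eq_fun do rewrite big_cons.
apply: CV_plus IHr; apply: CV_mult (cv i); exact: Un_cv_const.
Qed.

(** A lattice point is guaranteed only for width strictly above [F], so [c] is first shrunk by a
    factor 1 - e_n. Compactness then recovers the step for [c] itself. *)
Lemma lattice_step K F w c u : (0 < d)%N -> convex_body K -> is_Flt d F -> is_lattice_width K w ->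
  0 < c -> F * c <= w -> int_vec u -> (exists i, u i <> 0) ->
  exists a z, [/\ int_vec z, K a, K (fun i => c * z i + a i) & dotR u z <> 0].
Proof.
move=> d0 bK FltF wK c0 Fc u_int [i0 ui0].
have F0 := Flt_gt0 d0 FltF.
have [[x0 Kx0] [_ [clK [M KM]]]] := bK.
pose U := dotR u u.
have U0 : 0 < U.
  rewrite /U /dotR /sumR (bigD1 i0) //=; apply: Rplus_lt_le_0_compat.
    exact: Rsqr_pos_lt.
  by elim/big_ind: _ => [|a b|j _]; [lra | lra | apply: Rle_0_sqr].
have [||m [ub_m le_m]] := completeness (fun r => exists2 x, K x & r = dotR u x).
- exists (sumR (fun i => Rabs (u i) * M)) => _ [x Kx ->].
  rewrite /dotR /sumR; apply: (big_ind2 (fun a b => a <= b)); [lra | move=> *; lra | move=> i _].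
  apply: Rle_trans (Rle_abs _) _; rewrite Rabs_mult.
  by apply: Rmult_le_compat_l; [apply: Rabs_pos | apply: KM].
- by exists (dotR u x0), x0.
(* Starting at 1/2 keeps the factor [mu n] below at least c/2. *)
pose e n := / INR n.+2.
have e0 n : 0 < e n by apply/Rinv_0_lt_compat/lt_0_INR; lia.
have e12 n : e n <= / 2.
  by apply: Rinv_le_contravar; [lra | apply: (le_INR 2); lia].
have cv_e : Un_cv e 0.
  move=> r r0; have [N [Nr N0]] := archimed_cor1 r r0; exists N => n Nn.
  rewrite /Rdist Rminus_0_r Rabs_pos_eq; last exact: Rlt_le.
  apply: Rle_lt_trans Nr; apply: Rinv_le_contravar; first exact: lt_0_INR.
  apply: le_INR; lia.
have /choice[l lP] n : exists x, K x /\ m - e n < dotR u x.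
  apply: contrapT => no_x; suff : m <= m - e n by have := e0 n; lra.
  apply: le_m => _ [x Kx ->]; apply: Rnot_lt_le => lt_x; apply: no_x.
  by exists x.
pose mu n := c * (1 - e n).
have mu0 n : 0 < mu n by apply: Rmult_lt_0_compat => //; have := e12 n; lra.
(* The added multiple of [u] has [u]-value [e n], which lifts the near-maximal point [l n] beyond
   the maximum [m]; a lattice point [z] with [p n z] in [K] must then have negative [u]-value. *)
pose p n (z : vec d) := fun i => mu n * z i + (l n i + e n / U * u i).
have /choice[z zP] n : exists z, int_vec z /\ K (p n z).
  have := scaled_lattice_width (fun i => l n i + e n / U * u i) (mu0 n) wK.
  case/(lattice_width_gt_Flt FltF).
  - exact: scaled_convex_body.
  - apply: (Rmult_lt_reg_r (mu n)) => //.
    have -> : w / mu n * mu n = w by field; have := mu0 n; lra.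
    apply: Rlt_le_trans Fc; apply: Rmult_lt_compat_l => //.
    by rewrite /mu -[X in _ < X]Rmult_1_r; apply: Rmult_lt_compat_l => //; have := e0 n; lra.
  - by move=> z z_int Kz; exists z.
(* Integrality improves negative to at most -1, a bound that survives the limit. *)
have uz n : dotR u (z n) <= -1.
  have [z_int Kz] := zP n; have [Kl lt_l] := lP n.
  have : dotR u (p n (z n)) <= m by apply: ub_m; exists (p n (z n)).
  rewrite dotR_affine dotRD dotRZ -/U.
  have -> : e n / U * U = e n by field; lra.
  move=> le_m'; have : mu n * dotR u (z n) < 0 by lra.
  have [k ->] := is_int_dotR u_int z_int => mk0.
  have /lt_IZR : IZR k < 0.
    by apply: Rnot_le_lt => k0; have := Rmult_le_pos _ _ (Rlt_le _ _ (mu0 n)) k0; lra.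
  move=> k0; apply: (IZR_le _ (Zneg xH)); lia.
(* Here mu_n z_n is a difference of two points of [K] minus a short multiple of [u], and mu_n >=
   c/2. *)
pose B := 2 / c * (2 * M + sumR (fun i => Rabs (u i)) / U).
have M0 : 0 <= M by apply: Rle_trans (KM _ Kx0 i0); apply: Rabs_pos.
have zB n i : Rabs (z n i) <= B.
  have [_ Kz] := zP n; have [Kl _] := lP n.
  have := KM _ Kz i; have := KM _ Kl i; rewrite /p => lM pM.
  apply: (Rmult_le_reg_l (c / 2)); first lra.
  have -> : c / 2 * B = 2 * M + sumR (fun i => Rabs (u i)) / U by rewrite /B; field; lra.
  apply: (Rle_trans _ (mu n * Rabs (z n i))).
    apply: Rmult_le_compat_r; first exact: Rabs_pos.
    by rewrite /mu; have := e12 n; nra.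
  rewrite Rabs_scale //.
  have : Rabs (e n / U * u i) <= sumR (fun i => Rabs (u i)) / U.
    rewrite -Rabs_scale; last exact: Rdiv_lt_0_compat (e0 n) U0.
    have -> : e n / U * Rabs (u i) = e n * Rabs (u i) / U by field; lra.
    apply: Rmult_le_compat_r; first by apply/Rlt_le/Rinv_0_lt_compat.
    by have := Rabs_le_sumR u i; have := Rabs_pos (u i); have := e12 n; have := e0 n; nra.
  by move: lM pM; split_Rabs; lra.
(* Both sequences are packed into one family to get a common extraction. *)
pose s n (j : 'I_d + 'I_d) := match j with inl i => l n i | inr i => z n i end.
have [|phi [lim [ge_phi cv]]] := @bounded_family_cluster _ s (M + B).
  have B0 : 0 <= B by apply: Rle_trans (zB 0%N i0); apply: Rabs_pos.
  move=> n [i|i] /=; first by have [/KM/(_ i)] := lP n; lra.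
  by have := zB n i; lra.
have cv_ephi := Un_cv_reindex ge_phi cv_e.
pose a : vec d := fun i => lim (inl i); pose zz : vec d := fun i => lim (inr i).
exists a, zz; split.
- move=> i; apply: is_int_cv (cv (inr i)) => n; have [z_int _] := zP (phi n); exact: z_int.
- by apply: (clK (l \o phi)) => [n|i]; [have [] := lP (phi n) | apply: (cv (inl i))].
- apply: (clK (fun n => p (phi n) (z (phi n)))) => [n|i]; first by have [] := zP (phi n).
  rewrite /p.
  have -> : c * zz i + a i = c * (1 - 0) * zz i + (a i + 0 / U * u i) by field; lra.
  apply: CV_plus.
    apply: CV_mult (cv (inr i)); apply: CV_mult; first exact: Un_cv_const.
    by apply: CV_minus cv_ephi; apply: Un_cv_const.
  apply: CV_plus (cv (inl i)) _; apply: CV_mult; last exact: Un_cv_const.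
  by apply: CV_mult cv_ephi (Un_cv_const _).
have := @Un_cv_dotR u (z \o phi) zz (fun i => cv (inr i)).
move=> cvu uz0; have [|N] := cvu (/ 2); first lra.
move=> /(_ N (le_n N)); rewrite uz0 /Rdist /=; have := uz (phi N); split_Rabs; lra.
Qed.
End Widths.

(** * Passage between coordinate functions and column vectors *)

Section Transfer.
Local Open Scope ring_scope.

Lemma intRE (z : int) : intR z = z%:~R :> R.
Proof. by case: z => n; rewrite /intR INRE. Qed.

Lemma is_intP (r : R) : is_int r <-> exists z : int, r = z%:~R.
Proof.
split=> [[[|p|p] ->]|[[n|n] ->]].
- by exists 0.
- by exists (Posz (nat_of_pos p)); rewrite IZRposE INRE.
- by exists (- Posz (nat_of_pos p)); rewrite intrN -[RHS]/(- (nat_of_pos p)%:R) -INRE -IZRposE.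
- by exists (Z.of_nat n); rewrite -INR_IZR_INZ INRE.
- by exists (Z.opp (Z.of_nat n.+1)); rewrite opp_IZR -INR_IZR_INZ INRE.
Qed.

Variable d : nat.
Implicit Types (K : vec d -> Prop) (X : 'cV[R]_d).

Definition vec_of X : vec d := fun i => X i 0.

Lemma convex_vec_of K : convex K -> convex_mx (K \o vec_of).
Proof.
move=> cK x y t Kx Ky /andP[/RleP t0 /RleP t1]; have := cK _ _ t Kx Ky (conj t0 t1).
by congr K; apply: funext => i; rewrite /vec_of !mxE.
Qed.

Lemma vec_of_lattice_steps K F w c : (0 < d)%N -> convex_body K -> is_Flt d F ->
  is_lattice_width K w -> Rlt 0 c -> Rle (F * c) w ->
  lattice_steps (fun X => K (vec_of (c *: X))).
Proof.
move=> d0 bK FltF wK c0 Fc u u0.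
pose ur : vec d := fun i => (u 0 i)%:~R.
have [||a [z [z_int Ka Kz uz]]] := lattice_step (u := ur) d0 bK FltF wK c0 Fc.
- by move=> i; apply/is_intP; exists (u 0 i).
- have /rV0Pn[i ui] := u0; exists i; apply/eqP; by rewrite intr_eq0.
have /fin_all_exists[m zm] i : exists m : int, z i = m%:~R by apply/is_intP/z_int.
have c_neq0 : c != 0 by apply/eqP/Rgt_not_eq.
(* The body is divided by [c], so the base point becomes a / c while the lattice vector is
   unchanged. *)
exists (\col_i (a i / c)), (\col_i m i); split.
- by congr K: Ka; apply: funext => i; rewrite /vec_of !mxE mulrC divfK.
- congr K: Kz; apply: funext => i; rewrite /vec_of !mxE zm.
  by rewrite mulrDr [c * (a i / c)]mulrC divfK // addrC.
apply: contra_notN uz => /eqP um; rewrite -[RHS](rmorph0 (intr : int -> R)) -um mxE rmorph_sum.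
by apply: eq_bigr => i _; rewrite rmorphM /= mxE zm.
Qed.

Lemma affine_mapE (A : 'M[int]_d) X (x : vec d) :
  affine_map A (vec_of X) x = vec_of (map_mx intr A *m (\col_i x i) + X).
Proof.
apply: funext => i; rewrite /vec_of !mxE; congr (_ + _).
by apply: eq_bigr => j _; rewrite !mxE intRE.
Qed.

Lemma unimodular_unitmx (A : 'M[int]_d) : A \in unitmx -> unimodular_mx A.
Proof. by rewrite unitmxE qualifE => /orP[] /eqP ?; [left|right]. Qed.

Lemma std_simplex_col (x : vec d) : std_simplex x ->
  (forall i, 0 <= (\col_i x i : 'cV[R]_d) i 0) /\ \sum_i (\col_i x i : 'cV[R]_d) i 0 <= 1.
Proof.
move=> [x0 x1]; split=> [i|]; first by rewrite mxE; apply/RleP.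
by under eq_bigr do rewrite mxE; apply/RleP.
Qed.

End Transfer.

Theorem theorem2p1 (d : nat) (K : vec d -> Prop) (F w : R) :
  (0 < d)%N -> convex_body K -> is_Flt d F -> is_lattice_width K w ->
  (2 * F * INR d <= w -> contains_unimodular_simplex K) /\
  (F * INR d <= w -> contains_R_unimodular_simplex K).
Proof.
move=> d0 bK FltF wK; have [_ [/convex_vec_of cK _]] := bK.
have dR : 0 < INR d by apply: lt_0_INR; lia.
split=> Fw.
  (* The construction is run in K / 2, with [c] equal to 2d; the other half of the room serves to
     move the vertex to a lattice point. *)
  pose K2 (X : 'cV[R]_d) := K (vec_of (2%R *: X)%R).
  have cK2 : convex_mx K2.
    move=> x y t Kx Ky t01; have := cK _ _ _ Kx Ky t01; rewrite /K2 /=.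
    by rewrite scalerDr !scalerA ![(2 * _)%R]mulrC.
  have [|A [x [uA simplexK coverK]]] := lattice_steps_simplex d0 cK2.
    have D2 : 2 * INR d = (2%:R * d%:R)%R by rewrite -!INRE.
    have : F * (2 * INR d) <= w by lra.
    move/(vec_of_lattice_steps d0 bK FltF wK) => stepK u u0.
    have [|a [z [Ka Kz uz]]] := stepK _ u u0; first lra.
    by exists a, z; split; rewrite // /K2 scalerA -D2.
  (* This gives n - x in K / 2. Added to A p + x in K / 2 it cancels [x], so A p + n lies in [K] as
     the midpoint of the doubled points. *)
  have [n Kn] := coverK (- x)%R.
  exists A, (vec_of (map_mx intr n)); split; first exact: unimodular_unitmx.
  split=> [i|p /std_simplex_col[p0 p1]]; first by apply/is_intP; exists (n i ord0); rewrite /vec_of mxE.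
  rewrite affine_mapE.
  have h01 : (0 <= (2^-1 : R) <= 1)%R.
    by rewrite invr_ge0 ler0n invf_le1 ?ler1n ?ltr0n.
  have := cK _ _ _ (simplexK _ p0 p1) Kn h01; rewrite /=; congr (K (vec_of _)).
  have -> : (1 - 2^-1 = 2^-1 :> R)%R by rewrite {1}(splitr 1) mul1r addrK.
  rewrite !scalerA mulVf ?pnatr_eq0 // !scale1r addrA addrK.
  by [].
have [|A [x [uA simplexK _]]] := lattice_steps_simplex d0 cK.
  have := vec_of_lattice_steps d0 bK FltF wK dR Fw.
  by rewrite INRE.
exists A, (vec_of x); split; first exact: unimodular_unitmx.
by move=> p /std_simplex_col[p0 p1]; rewrite affine_mapE; apply: simplexK.
Qed.
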